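(* Let $\beta>0$ be an integer, let $d=\max_i d_i$, let $K_1,\dots,K_p\subseteq[p]$, and let $K=\operatorname{argmax}_{\{K_i : i\in[p]\}}|K_i|$. Then the local ordering scores $\mathrm{los}(i,L;\mathbf{x})$, for all $i\in[p]$ and all $L\subseteq K_i$, may be computed in time $$\mathcal{O}\bigl(p\,2^{|K|}\,|\mathcal{S}_{K,\beta}|\,d^{\beta}\bigr).$$
   Context: Let $X_1,\dots,X_p$ be categorical variables, $X_i$ having state space $\mathcal{X}_i=[d_i]=\{1,\dots,d_i\}$ with $d_i>1$, and put $\mathcal{X}_S=\prod_{k\in S}\mathcal{X}_k$ for $S\subseteq[p]$. For $L\subseteq[p]$, let $\mathcal{S}_{L,\beta}$ be the set of stagings using context variables in $L$ with at most $\beta$ context variables per stage, i.e. the set of partitions of $\mathcal{X}_L$ all of whose blocks are of the form $\mathcal{S}(\mathbf{x}_S)=\{\mathbf{y}\in\mathcal{X}_L : \mathbf{y}_S=\mathbf{x}_S\}$ for some $S\subseteq L$ with $|S|\le\beta$ and some $\mathbf{x}_S\in\mathcal{X}_S$. The set $\mathcal{S}(\mathbf{x}_S)$ is called the stage with context $\mathbf{x}_S$. Data $\mathbf{x}$: a finite sample of points of $\prod_{i=1}^p[d_i]$. For $i\in[p]$, a stage $s=\mathcal{S}(\mathbf{x}_S)$ and $k\in[d_i]$, let $N_{isk}$ be the number of data points $\mathbf{y}$ with $y_i=k$ and $\mathbf{y}_S=\mathbf{x}_S$. Let $\alpha_{isk}>0$ be given Dirichlet hyperparameters (depending only on $i$,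 $\mathbf{x}_S$, $k$). Put $N_{is}=\sum_{k=1}^{d_i}N_{isk}$ and $\alpha_{is}=\sum_{k=1}^{d_i}\alpha_{isk}$. The context marginal likelihood is $$z_{i,\mathbf{x}_S}=\frac{\Gamma(\alpha_{is})}{\Gamma(\alpha_{is}+N_{is})}\prod_{k=1}^{d_i}\frac{\Gamma(\alpha_{isk}+N_{isk})}{\Gamma(\alpha_{isk})},$$ and for $L\subseteq K_i$ the local ordering score is $$\mathrm{los}(i,L;\mathbf{x})=\sum_{\mathbf{s}_i\in\mathcal{S}_{L,\beta}}\frac{1}{i\,|\mathcal{S}_{L,\beta}|}\prod_{\mathcal{S}(\mathbf{x}_S)\in\mathbf{s}_i}z_{i,\mathbf{x}_S}.$$ Cost model: arithmetic operations and evaluations of $\Gamma$ have unit cost, the counts $N_{isk}$ are precomputed and accessible in $\mathcal{O}(1)$ time, computed values $z_{i,\mathbf{x}_S}$ are stored and accessible in $\mathcal{O}(1)$ time, and the elements of the sets $\mathcal{S}_{L,\beta}$ are available as an explicit enumeration.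
   Formalization: Adds the assumption that |S_{K_i,β}| ≤ |S_{K,β}| for all i (K also has the most stagings), and for β = 1 the cost of computing the values z is not charged (they are taken as stored); with all costs charged the bound fails otherwise. *)

(* Defs.v *)
From mathcomp Require Import all_boot all_order all_algebra.
From mathcomp Require Import all_classical all_reals all_analysis.

Set Implicit Arguments.
Unset Strict Implicit.
Unset Printing Implicit Defensive.

Import Order.TTheory GRing.Theory Num.Theory.
Local Open Scope ring_scope.

(* Variables are indexed by 'I_p and states of variable k by 'I_(d k), so both
   are 0-based: the mathematical variable i is the ordinal of value i.-1. *)

Definition outcome (p : nat) (d : 'I_p -> nat) : Type :=
  {dffun forall k : 'I_p, 'I_(d k)}.

(* A pair (S, x_S) with x_S in X_S is encoded as a partial assignment: S is the
   set of variables on which it is defined. *)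
Definition assignment (p : nat) (d : 'I_p -> nat) : finType :=
  {dffun forall k : 'I_p, option 'I_(d k)}.

Section Stagings.
Variables (p : nat) (d : 'I_p -> nat).
Implicit Types (c y : assignment d) (L : {set 'I_p}).

Definition dom c : {set 'I_p} := [set k | c k != None].

Definition cells L : {set assignment d} := [set y | dom y == L].

(* y_S = x_S, where c encodes (S, x_S) *)
Definition agree y c : bool := [forall (k | k \in dom c), y k == c k].

Definition stage L c : {set assignment d} := [set y in cells L | agree y c].

Definition stagings (beta : nat) L : {set {set {set assignment d}}} :=
  [set s : {set {set assignment d}} | finset.partition s (cells L) &
    [forall (B | B \in s), exists c : assignment d,
      [&& dom c \subset L, (#|dom c| <= beta)%N & B == stage L c]]].

Definition full (y : outcome d) : assignment d := [ffun k => Some (y k)].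

Definition count_of (x : seq (outcome d)) (i : 'I_p) c (k : 'I_(d i)) : nat :=
  count (fun y : outcome d => (y i == k) && agree (full y) c) x.

End Stagings.

Definition Gamma (R : realType) (a : R) : R :=
  Rintegral (@lebesgue_measure R) `]0, +oo[%classic
    (fun t : R => t `^ (a - 1) * expR (- t)).

Definition hyper (R : realType) (p : nat) (d : 'I_p -> nat) : Type :=
  forall i : 'I_p, assignment d -> 'I_(d i) -> R.

Section Scores.
Variables (R : realType) (p : nat) (d : 'I_p -> nat).
Variables (x : seq (outcome d)) (alpha : hyper R d).

Definition marginal (i : 'I_p) (c : assignment d) : R :=
  let a := \sum_(k < d i) alpha c k in
  let n := (\sum_(k < d i) count_of x c k)%N in
  Gamma a / Gamma (a + n%:R) *
  \prod_(k < d i) (Gamma (alpha c k + (count_of x c k)%:R) / Gamma (alpha c k)).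

(* Since every d k > 1, a nonempty stage has a unique context with domain
   included in L, so the product over the stages of s is indexed by contexts. *)
Definition los (beta : nat) (i : 'I_p) (L : {set 'I_p}) : R :=
  \sum_(s in stagings d beta L)
    1 / (i.+1%:R * #|stagings d beta L|%:R) *
    \prod_(c : assignment d | (dom c \subset L) && (stage L c \in s))
      marginal i c.

End Scores.

(* Unit-cost model: straight-line programs over the reals. Each instruction
   appends one value to the memory; a nat operand is the address of a previously
   computed value, so stored values are reread for free. I is the type of input
   locations. *)
Inductive instr (I : Type) : Type :=
  | Literal of nat
  | Fetch of I
  | Add of nat & nat
  | Sub of nat & nat
  | Mul of nat & nat
  | Div of nat & nat
  | GammaOf of nat.

Section Machine.
Variables (R : realType) (I : Type) (input : I -> R).

Definition exec1 (m : seq R) (e : instr I) : R :=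
  match e with
  | Literal n => n%:R
  | Fetch l => input l
  | Add a b => m`_a + m`_b
  | Sub a b => m`_a - m`_b
  | Mul a b => m`_a * m`_b
  | Div a b => m`_a / m`_b
  | GammaOf a => Gamma m`_a
  end.

Definition exec (prog : seq (instr I)) : seq R :=
  foldl (fun m e => rcons m (exec1 m e)) [::] prog.

End Machine.

Section Inputs.
Variables (R : realType) (p : nat) (d : 'I_p -> nat).

Inductive raw_location : Type :=
  | Count (i : 'I_p) (c : assignment d) (k : 'I_(d i))
  | Hyper (i : 'I_p) (c : assignment d) (k : 'I_(d i)).

Definition raw_input (x : seq (outcome d)) (alpha : hyper R d)
    (l : raw_location) : R :=
  match l with
  | Count i c k => (count_of x c k)%:R
  | Hyper i c k => alpha i c k
  end.

Definition stored_input (x : seq (outcome d)) (alpha : hyper R d)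
    (l : 'I_p * assignment d) : R :=
  marginal x alpha l.1 l.2.

(* One program, fixed before the data and the hyperparameters, computes all the
   scores los(i, L) for L included in Ks i within time T; [out] gives the
   addresses of the results. *)
Definition scores_computable_in_time (I : Type)
    (input : seq (outcome d) -> hyper R d -> I -> R)
    (beta : nat) (Ks : 'I_p -> {set 'I_p}) (T : nat) : Prop :=
  exists (prog : seq (instr I)) (out : 'I_p -> {set 'I_p} -> nat),
    (size prog <= T)%N /\
    forall (x : seq (outcome d)) (alpha : hyper R d),
      (forall (i : 'I_p) (c : assignment d) (k : 'I_(d i)), 0 < alpha i c k) ->
      forall (i : 'I_p) (L : {set 'I_p}), L \subset Ks i ->
        (exec (input x alpha) prog)`_(out i L) = los x alpha beta i L.

End Inputs.

(* Main.v *)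
Require Import Defs.
From mathcomp Require Import all_boot all_order all_algebra.
From mathcomp Require Import all_classical all_reals all_analysis.
From mathcomp Require Import fintype finset.
From mathcomp Require Import zify.

Set Implicit Arguments.
Unset Strict Implicit.
Unset Printing Implicit Defensive.

(* Every stage has at most beta context variables, hence mass at least d^-beta
   under the uniform distribution on X_L; so a staging has at most d^beta stages,
   and los(i, L) costs O(|S_{L,beta}| d^beta) once the marginals are stored.
   Pulling stagings back along X_{K_i} -> X_L gives |S_{L,beta}| <=
   |S_{K_i,beta}|, whence the bound after summing over the 2^|K_i| subsets L.
   Computing one marginal from the counts costs O(d). The number of contexts is
   at most 2^|L| m^beta with m = max_{k in L} d_k, and m <= |S_{L,beta}| when
   beta, |L| >= 2, so the additional factor d is absorbed by
   m^beta d <= m d^beta <= |S_{L,beta}| d^beta. *)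

Import Order.TTheory GRing.Theory Num.Theory.

(** * Straight-line programs: composition and instruction counts *)

Section StraightLinePrograms.
Local Open Scope ring_scope.
Variables (R : realType) (I X : Type) (inp : X -> I -> R).
Implicit Types (prog q : seq (instr I)) (f g : X -> R) (G : (X -> R) -> Prop).

Lemma size_exec (input : I -> R) prog : size (exec input prog) = size prog.
Proof.
elim/last_ind: prog => // prog e IH.
by rewrite /exec foldl_rcons -/(exec _ _) !size_rcons IH.
Qed.

Lemma nth_exec_cat (input : I -> R) prog q a : (a < size prog)%N ->
  (exec input (prog ++ q))`_a = (exec input prog)`_a.
Proof.
move=> ap; elim/last_ind: q => [|q e IH]; first by rewrite cats0.
rewrite -rcons_cat /exec foldl_rcons -/(exec _ _) nth_rcons size_exec.
by rewrite size_cat ltn_addr.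
Qed.

(** The address [a] is chosen before [x]: program and addresses do not depend on the data, which [X]
    parametrizes. *)
Definition holds prog f : Prop :=
  exists2 a, (a < size prog)%N & forall x, (exec (inp x) prog)`_a = f x.

Lemma holds_cat prog q f : holds prog f -> holds (prog ++ q) f.
Proof.
case=> a ap fE; exists a => [|x]; first by rewrite size_cat ltn_addr.
by rewrite nth_exec_cat.
Qed.

Lemma holds_rcons prog (e : instr I) f :
  (forall x, exec1 (inp x) (exec (inp x) prog) e = f x) ->
  holds (rcons prog e) f.
Proof.
move=> fE; exists (size prog) => [|x]; first by rewrite size_rcons.
rewrite /exec foldl_rcons -/(exec _ _) nth_rcons size_exec ltnn eqxx.
exact: fE.
Qed.

(* From any memory that contains the values in [G], [n] further instructions
   produce [f]. *)
Definition computable G (n : nat) f : Prop :=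
  forall prog, (forall g, G g -> holds prog g) ->
  exists2 q, (size q <= n)%N & holds (prog ++ q) f.

(** Operands are addresses, so rereading a stored value takes no instruction. *)
Lemma computable_mem G f : G f -> computable G 0 f.
Proof. by move=> Gf prog Gprog; exists [::]; rewrite ?cats0; auto. Qed.

Lemma computable_ext G n f g : f =1 g -> computable G n f -> computable G n g.
Proof.
move=> fg cf prog /cf[q qn [a aq fE]]; exists q => //; exists a => // x.
by rewrite fE fg.
Qed.

Lemma computable_leq G m n f :
  (m <= n)%N -> computable G m f -> computable G n f.
Proof.
by move=> mn cf prog /cf[q qn fE]; exists q => //; exact: leq_trans mn.
Qed.

Lemma computable_nat G (k : nat) : computable G 1 (fun=> k%:R).
Proof.
by move=> prog _; exists [:: Literal I k] => //; rewrite cats1;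
   apply: holds_rcons.
Qed.

Lemma computable_input G (l : I) : computable G 1 (inp^~ l).
Proof.
by move=> prog _; exists [:: Fetch l] => //; rewrite cats1; apply: holds_rcons.
Qed.

Lemma computable_op1 (op : R -> R) (mk : nat -> instr I) G n f :
  (forall x m a, exec1 (inp x) m (mk a) = op m`_a) ->
  computable G n f -> computable G n.+1 (fun x => op (f x)).
Proof.
move=> opE cf prog /cf[q qn [a aq fE]].
exists (rcons q (mk a)); first by rewrite size_rcons.
by rewrite -rcons_cat; apply: holds_rcons => x; rewrite opE fE.
Qed.

Lemma computable_op2 (op : R -> R -> R) (mk : nat -> nat -> instr I) G m n f g :
  (forall x s a b, exec1 (inp x) s (mk a b) = op s`_a s`_b) ->
  computable G m f -> computable G n g ->
  computable G (m + n).+1 (fun x => op (f x) (g x)).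
Proof.
move=> opE cf cg prog Gprog; have [q qm fq] := cf prog Gprog.
have [|r rn [b br gE]] := cg (prog ++ q).
  by move=> h /Gprog; exact: holds_cat.
have [a ar fE] := holds_cat r fq.
exists (rcons (q ++ r) (mk a b)).
  by rewrite size_rcons size_cat ltnS leq_add.
rewrite -rcons_cat catA; apply: holds_rcons => x.
by rewrite opE fE gE.
Qed.

Definition computable_Gamma G n f :=
  @computable_op1 (@Gamma R) (@GammaOf I) G n f (fun _ _ _ => erefl).
Definition computable_add G m n f g :=
  @computable_op2 +%R (@Add I) G m n f g (fun _ _ _ _ => erefl).
Definition computable_mul G m n f g :=
  @computable_op2 *%R (@Mul I) G m n f g (fun _ _ _ _ => erefl).
Definition computable_div G m n f g :=
  @computable_op2 (fun a b => a / b) (@Div I) G m n f g (fun _ _ _ _ => erefl).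

(** One literal starts the fold, and each selected index adds one operation to its own cost. The
    filter [P] is resolved while the program is written, so rejected indices cost nothing. *)
Lemma computable_bigop (op : R -> R -> R) (mk : nat -> nat -> instr I) (e : nat)
    (J : Type) (s : seq J) (P : pred J) G (n : J -> nat) (F : J -> X -> R) :
  (forall x m a b, exec1 (inp x) m (mk a b) = op m`_a m`_b) ->
  (forall j, P j -> computable G (n j) (F j)) ->
  computable G (\sum_(j <- s | P j) (n j).+1).+1
    (fun x => \big[op/e%:R]_(j <- s | P j) F j x).
Proof.
move=> opE cF; elim: s => [|j s IH].
  rewrite big_nil; apply: computable_ext _ (computable_nat e) => x.
  by rewrite big_nil.
rewrite big_cons; case: ifPn => Pj; last first.
  by apply: computable_ext _ IH => x; rewrite big_cons (negbTE Pj).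
apply: computable_ext _ (computable_leq _ (computable_op2 opE (cF j Pj) IH)).
  by move=> x; rewrite big_cons Pj.
by rewrite addSn addnS.
Qed.

Definition computable_sum J s P G n F :=
  @computable_bigop +%R (@Add I) 0 J s P G n F (fun _ _ _ _ => erefl).
Definition computable_prod J s P G n F :=
  @computable_bigop *%R (@Mul I) 1 J s P G n F (fun _ _ _ _ => erefl).

(** Programs are concatenated and memory only grows, so every [F j] stays addressable afterwards.
    This is what allows marginals to be computed once and shared by all scores. *)
Lemma computable_family (J : eqType) (s : seq J) (P : pred J) G (n : J -> nat)
    (F : J -> X -> R) prog :
  (forall g, G g -> holds prog g) ->
  (forall j, P j -> computable G (n j) (F j)) ->
  exists2 q, (size q <= \sum_(j <- s | P j) n j)%N &
    forall j, j \in s -> P j -> holds (prog ++ q) (F j).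
Proof.
move=> Gprog cF; elim: s => [|j s [q qn hq]]; first by exists [::].
rewrite big_cons; case: ifPn => Pj; last first.
  exists q => // k; rewrite inE => /predU1P[->|ks Pk]; last exact: hq.
  by rewrite (negbTE Pj).
have [|r rn hr] := cF j Pj (prog ++ q).
  by move=> g /Gprog; exact: holds_cat.
exists (q ++ r); first by rewrite size_cat addnC leq_add.
move=> k; rewrite inE catA => /predU1P[-> //|ks Pk].
by apply: holds_cat; exact: hq.
Qed.

End StraightLinePrograms.

(** Two points of [D] share a block exactly when the function identifies them, so the partition
    determines the kernel. The two injectivity arguments on stagings below rest on this. *)
Lemma preim_partition_eqE (T : finType) (rT1 rT2 : eqType)
    (f : T -> rT1) (g : T -> rT2) (D : {set T}) :
  preim_partition f D = preim_partition g D ->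
  {in D &, forall y z, (f y == f z) = (g y == g z)}.
Proof.
move=> fg y z yD zD.
have fE : {in D & &, equivalence_rel (fun a b => f a == f b)}.
  by split=> // /eqP->.
have gE : {in D & &, equivalence_rel (fun a b => g a == g b)}.
  by split=> // /eqP->.
rewrite -(pblock_equivalence_partition fE) //.
rewrite -(pblock_equivalence_partition gE) //.
by rewrite -/(preim_partition f D) fg.
Qed.

(** * Partial assignments and the stages they determine *)

Section Stagings.
Variables (p : nat) (d : 'I_p -> nat).
Hypothesis d_gt1 : forall k, (1 < d k)%N.
Implicit Types (c y z : assignment d) (L S K : {set 'I_p}).

Lemma in_cells L y : (y \in cells d L) = (dom y == L).
Proof. by rewrite inE. Qed.

Lemma in_stage L c y : (y \in stage L c) = (y \in cells d L) && agree y c.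
Proof. by rewrite inE. Qed.

Lemma agreeP y c : reflect {in dom c, forall k, y k = c k} (agree y c).
Proof.
apply: (iffP forall_inP) => H k kc; first exact/eqP/H.
exact/eqP/H.
Qed.

Lemma domPn y k : reflect (y k = None) (k \notin dom y).
Proof. by rewrite inE negbK; exact: eqP. Qed.

Definition restrict S y : assignment d :=
  [ffun k => if k \in S then y k else None].

Lemma dom_restrict S y : dom (restrict S y) = S :&: dom y.
Proof. by apply/setP => k; rewrite !inE ffunE; case: (k \in S). Qed.

Lemma agree_restrict S y z : S \subset dom y ->
  agree z (restrict S y) = (restrict S z == restrict S y).
Proof.
move=> Sy; have domS : dom (restrict S y) = S.
  by rewrite dom_restrict; exact/setIidPl.
apply/agreeP/eqP => [H|/ffunP H k].
  apply/ffunP => k; rewrite !ffunE; case: ifP => // kS.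
  by rewrite H ?domS // ffunE kS.
by rewrite domS => kS; have := H k; rewrite !ffunE kS.
Qed.

Definition overwrite y c : assignment d :=
  [ffun k => if k \in dom c then c k else y k].

Lemma dom_overwrite y c : dom (overwrite y c) = dom y :|: dom c.
Proof.
apply/setP => k; rewrite !inE ffunE inE.
by case: (c k) => [a|] /=; rewrite ?orbT ?orbF.
Qed.

Lemma agree_overwrite y c : agree (overwrite y c) c.
Proof. by apply/agreeP => k kc; rewrite ffunE kc. Qed.

Definition default S : assignment d :=
  [ffun k => if k \in S then Some (Ordinal (ltnW (d_gt1 k))) else None].

Lemma dom_default S : dom (default S) = S.
Proof. by apply/setP => k; rewrite inE ffunE; case: (k \in S). Qed.

Lemma cells_neq0 L : exists y, y \in cells d L.
Proof. by exists (default L); rewrite in_cells dom_default. Qed.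

Definition complete L c : assignment d := overwrite (default L) c.

Lemma complete_stage L c : dom c \subset L -> complete L c \in stage L c.
Proof.
move=> cL; rewrite in_stage in_cells agree_overwrite dom_overwrite dom_default.
by rewrite andbT; apply/eqP/setUidPl.
Qed.

Lemma exists_neq k (a : option 'I_(d k)) : exists v : 'I_(d k), Some v != a.
Proof.
have [->|a0] := eqVneq a (Some (Ordinal (ltnW (d_gt1 k)))).
  by exists (Ordinal (d_gt1 k)).
by exists (Ordinal (ltnW (d_gt1 k))); rewrite eq_sym.
Qed.

(** The state space depends on the variable, hence the cast along [k = j]. *)
Definition update y k (v : 'I_(d k)) : assignment d :=
  @finfun _ (fun j => option 'I_(d j))
    (fun j => if @eqP _ k j is ReflectT e then Some (ecast j 'I_(d j) e v)
              else y j).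

Lemma update_eq y k (v : 'I_(d k)) : update y v k = Some v.
Proof. by rewrite ffunE; case: eqP => // e; rewrite eq_axiomK. Qed.

Lemma update_neq y k (v : 'I_(d k)) j : j != k -> update y v j = y j.
Proof. by move=> jk; rewrite ffunE; case: eqP => // kj; case/eqP: jk. Qed.

Lemma dom_update y k (v : 'I_(d k)) : k \in dom y -> dom (update y v) = dom y.
Proof.
move=> ky; apply/setP => j; have [->|jk] := eqVneq j k.
  by rewrite ky inE update_eq.
by rewrite !inE update_neq.
Qed.

(* A stage varies in every coordinate of [L] outside the domain of its context
   because each variable has at least two states. *)
Lemma sub_stage_dom L c c' : dom c \subset L -> dom c' \subset L ->
  stage L c \subset stage L c' -> dom c' \subset dom c.
Proof.
move=> cL c'L /subsetP cc'; apply/subsetP => k kc'.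
apply: contraT => kc; have [v vc'] := exists_neq (c' k).
have := complete_stage cL; set y := complete L c; rewrite in_stage in_cells.
case/andP=> /eqP yL /agreeP yc.
have : update y v \in stage L c.
  rewrite in_stage in_cells dom_update ?yL ?eqxx /=; last exact: (subsetP c'L).
  apply/agreeP => j jc; rewrite update_neq; first exact: yc.
  by apply: contraNneq kc => <-.
move/cc'; rewrite in_stage => /andP[_ /agreeP /(_ k kc')].
by rewrite update_eq => /eqP; rewrite (negbTE vc').
Qed.

(** Mutual inclusion of the stages forces equal domains, and any common point of the stages then
    determines both contexts on that domain. *)
Lemma stage_inj L c c' : dom c \subset L -> dom c' \subset L ->
  stage L c = stage L c' -> c = c'.
Proof.
move=> cL c'L cc'.
have dcc' : dom c = dom c'.
  by apply/eqP; rewrite eqEsubset !(@sub_stage_dom L) // cc'.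
have := complete_stage cL; have := complete_stage cL; rewrite {2}cc' !in_stage.
move=> /andP[_ /agreeP yc] /andP[_ /agreeP yc'].
apply/ffunP => k; have [kc|kc] := boolP (k \in dom c).
  by rewrite -yc // yc' -?dcc'.
by move: (kc); rewrite dcc' => /domPn ->; apply/domPn.
Qed.

(** * Constructing stagings and comparing their numbers *)

Lemma stagingsP beta L (s : {set {set assignment d}}) :
  reflect (partition s (cells d L) /\
    forall B, B \in s -> exists c,
      [/\ dom c \subset L, (#|dom c| <= beta)%N & B = stage L c])
  (s \in stagings d beta L).
Proof.
rewrite inE; apply: (iffP andP) => -[ps H]; split=> //.
  move=> B Bs; have /forall_inP/(_ B Bs)/existsP[c /and3P[? ? /eqP]] := H.
  by exists c.
apply/forall_inP => B /H[c [cL cb ->]]; apply/existsP; exists c.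
by rewrite cL cb eqxx.
Qed.

(** General way to produce stagings: the fibre of [f] through [y] is the stage with context
    [ctx y]. *)
Lemma preim_partition_staging (rT : eqType) beta L (f : assignment d -> rT)
    (ctx : assignment d -> assignment d) :
  (forall y, y \in cells d L ->
    [/\ dom (ctx y) \subset L, (#|dom (ctx y)| <= beta)%N &
      forall z, z \in cells d L -> (f y == f z) = agree z (ctx y)]) ->
  preim_partition f (cells d L) \in stagings d beta L.
Proof.
move=> H; apply/stagingsP; split; first exact: preim_partitionP.
move=> B /imsetP[y yL ->]; have [cL cb fE] := H y yL.
exists (ctx y); split=> //; apply/setP => z; rewrite in_stage inE.
by case: (boolP (z \in cells d L)) => //= zL; exact: fE.
Qed.

(** The partition with a single block is a staging, whose context is empty. *)
Lemma stagings_gt0 beta L : (0 < #|stagings d beta L|)%N.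
Proof.
apply/card_gt0P; exists (preim_partition (fun=> tt) (cells d L)).
apply: (@preim_partition_staging _ _ _ _ (restrict set0)) => y _.
have d0 : dom (restrict set0 y) = set0.
  by rewrite dom_restrict set0I.
rewrite d0 sub0set cards0; split=> // z _; apply/esym/agreeP => k.
by rewrite d0 inE.
Qed.

(** A staging of [cells d L] is pulled back along the restriction from [cells d K]. Contexts of
    blocks are unchanged, and the pullback is injective because restriction is onto [cells d L]. *)
Lemma stagings_mono beta L K : L \subset K ->
  (#|stagings d beta L| <= #|stagings d beta K|)%N.
Proof.
move=> LK; pose r s := pblock s \o restrict L.
have rL y : y \in cells d K -> restrict L y \in cells d L.
  by rewrite !in_cells dom_restrict => /eqP ->; apply/eqP/setIidPl.
have ext y : y \in cells d L -> exists2 z, z \in cells d K & restrict L z = y.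
  rewrite in_cells => /eqP yL; exists (complete K y).
    by have := @complete_stage K y; rewrite yL LK in_stage => /(_ isT)/andP[].
  apply/ffunP => k; rewrite !ffunE yL; case: (boolP (k \in L)) => //.
  by rewrite -yL => /domPn.
pose F s := preim_partition (r s) (cells d K).
have F_inj : {in stagings d beta L &, injective F}.
  move=> s s' /stagingsP[ps _] /stagingsP[ps' _] /preim_partition_eqE ss'.
  rewrite -(preim_partition_pblock ps) -(preim_partition_pblock ps').
  apply/eq_in_imset => y yL; apply/setP => z; rewrite !inE.
  case: (boolP (dom z == L)) => //=; rewrite -in_cells => zL.
  have [y' y'K <-] := ext _ yL; have [z' z'K <-] := ext _ zL.
  exact: ss'.
suff /subset_leq_card : F @: stagings d beta L \subset stagings d beta K.
  by rewrite (card_in_imset F_inj).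
apply/subsetP => _ /imsetP[s /stagingsP[ps bs] ->].
(* The context of [y] is any context of the block of [restrict L y]; one always exists, so the
   default [y] is never reached. *)
apply: (@preim_partition_staging _ _ _ _
  (fun y => odflt y [pick c : assignment d | [&& dom c \subset L,
     (#|dom c| <= beta)%N & pblock s (restrict L y) == stage L c]])) => y yK.
have yc : restrict L y \in cover s by rewrite (cover_partition ps) rL.
case: pickP => [c /and3P[cL cb /eqP yE]|]; last first.
  have [c [cL cb cE]] := bs _ (pblock_mem yc).
  by move/(_ c); rewrite cL cb cE eqxx.
split=> //=; first exact: subset_trans LK.
move=> z zK; rewrite eq_pblock ?(partition_trivIset ps) // yE in_stage rL //=.
apply: eq_forallb => k; case: (boolP (k \in dom c)) => //= kc.
by rewrite ffunE (subsetP cL).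
Qed.

Lemma sum_stagings_leq beta L :
  (\sum_(S : {set 'I_p} | S \subset L) #|stagings d beta S| <=
     2 ^ #|L| * #|stagings d beta L|)%N.
Proof.
rewrite -card_powerset -sum_nat_const.
rewrite [leqRHS](eq_bigl _ _ (fun S => powersetE S L)).
by apply: leq_sum => S; exact: stagings_mono.
Qed.

(** * Sizes of cells, stages and stagings *)

Lemma card_cells S : #|cells d S| = (\prod_(k in S) d k)%N.
Proof.
pose F k : pred (option 'I_(d k)) := fun a => (a != None) == (k \in S).
have -> : #|cells d S| = #|(family F : simpl_pred (assignment d))|.
  apply: eq_card => y; rewrite in_cells; apply/eqP/familyP => [yS k|H].
    by rewrite unfold_in /F -yS inE eqxx.
  by apply/setP => k; rewrite inE; have := H k; rewrite unfold_in => /eqP.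
rewrite card_family foldrE big_map big_enum [RHS]big_mkcond /=.
apply: eq_bigr => k _; case: ifP => kS.
  have Some_inj : injective (@Some 'I_(d k)) by move=> ? ? [].
  rewrite -[RHS]card_ord -(card_imset _ Some_inj).
  apply: eq_card => -[a|]; rewrite unfold_in /F kS /=.
    by rewrite imset_f.
  by apply/esym/negbTE/imsetP => -[].
rewrite -(card1 (None : option 'I_(d k))); apply: eq_card => a.
by rewrite unfold_in /F kS inE; case: a.
Qed.

Lemma card_cells_leq S L e b : S \subset L -> (#|S| <= b)%N ->
  (forall k, k \in L -> d k <= e)%N -> (0 < e)%N -> (#|cells d S| <= e ^ b)%N.
Proof.
move=> SL Sb de e0; rewrite card_cells.
apply: (@leq_trans (\prod_(k in S) e)%N).
  by apply: leq_prod => k /(subsetP SL); exact: de.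
by rewrite prod_nat_const leq_pexp2l.
Qed.

(** A point is recovered from its version overwritten by [c], which lies in the stage, together with
    its own values on [dom c]. This embeds the cells into a product. *)
Lemma card_cells_stage L c : dom c \subset L ->
  (#|cells d L| <= #|stage L c| * #|cells d (dom c)|)%N.
Proof.
move=> cL; rewrite -cardsX.
pose h y := (overwrite y c, restrict (dom c) y).
rewrite -(@card_in_imset _ _ h); last first.
  move=> y z _ _ [/ffunP o /ffunP r]; apply/ffunP => k.
  by have := o k; have := r k; rewrite !ffunE; case: ifP.
apply/subset_leq_card/subsetP => _ /imsetP[y + ->].
rewrite in_cells => /eqP yL; rewrite inE /= in_stage agree_overwrite.
rewrite !in_cells dom_overwrite dom_restrict yL.
by rewrite (setIidPl cL) (setUidPl cL) !eqxx.
Qed.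

(* Under the uniform distribution on [cells d L] every stage has mass at least
   [e ^- beta]. *)
Lemma card_staging beta L e (s : {set {set assignment d}}) :
  (forall k, k \in L -> d k <= e)%N -> (0 < e)%N ->
  s \in stagings d beta L -> (#|s| <= e ^ beta)%N.
Proof.
move=> de e0 /stagingsP[ps bs].
have cells_gt0 : (0 < #|cells d L|)%N.
  by apply/card_gt0P; have [y] := cells_neq0 L; exists y.
rewrite -(leq_pmul2r cells_gt0) {2}(card_partition ps) -sum_nat_const.
rewrite big_distrr; apply: leq_sum => B /bs[c [cL cb ->]].
apply: leq_trans (card_cells_stage cL) _.
by rewrite mulnC leq_mul2r (card_cells_leq cL) ?orbT.
Qed.

(** The product in [los] runs over contexts; injectivity of [stage L] turns the bound on the number
    of blocks into a bound on its number of factors. *)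
Lemma card_staging_contexts beta L e (s : {set {set assignment d}}) :
  (forall k, k \in L -> d k <= e)%N -> (0 < e)%N ->
  s \in stagings d beta L ->
  (#|[set c : assignment d | (dom c \subset L) && (stage L c \in s)]|
     <= e ^ beta)%N.
Proof.
move=> de e0 sL; apply: leq_trans (card_staging de e0 sL).
rewrite -(@card_in_imset _ _ (stage L)).
  by apply/subset_leq_card/subsetP => _ /imsetP[c + ->]; rewrite inE => /andP[].
by move=> c c'; rewrite !inE => /andP[+ _] /andP[+ _]; exact: stage_inj.
Qed.

Lemma staging_context_card beta L (s : {set {set assignment d}}) c :
  s \in stagings d beta L -> dom c \subset L -> stage L c \in s ->
  (#|dom c| <= beta)%N.
Proof.
move=> /stagingsP[_ bs] cL /bs[c' [c'L c'b cc']].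
by rewrite (stage_inj cL c'L cc').
Qed.

(** * Number of contexts, and number of states against number of stagings *)

Definition contexts beta L : {set assignment d} :=
  [set c | (dom c \subset L) && (#|dom c| <= beta)%N].

(** Contexts are sorted by their domain [S], one of [2 ^ #|L|] subsets; those with domain [S] are
    elements of [cells d S]. *)
Lemma card_contexts beta L M :
  (forall S, S \subset L -> #|S| <= beta -> #|cells d S| <= M)%N ->
  (#|contexts beta L| <= 2 ^ #|L| * M)%N.
Proof.
move=> HM; rewrite -sum1_card (partition_big (@dom p d) (mem (powerset L))) /=.
  rewrite -card_powerset -sum_nat_const; apply: leq_sum => S.
  rewrite powersetE => SL.
  have [Sb|Sb] := leqP #|S| beta.
    apply: leq_trans (HM S SL Sb); rewrite -sum1_card.
    rewrite [X in (X <= _)%N]big_mkcond [X in (_ <= X)%N]big_mkcond.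
    apply: leq_sum => c _; rewrite in_cells.
    by case: (dom c == S); rewrite ?andbF // andbT; case: ifP.
  rewrite big1 // => c; rewrite inE => /andP[/andP[_ cb] /eqP cS].
  by move: Sb; rewrite ltnNge -cS cb.
by move=> c; rewrite inE powersetE => /andP[].
Qed.

(* For each state [v] of [X_k], split on [X_k] and then split the stage
   [x_k = v] further on a second variable [X_l]: this gives [d k] stagings. *)
Lemma leq_card_stagings beta L k : (1 < beta)%N -> (1 < #|L|)%N -> k \in L ->
  (d k <= #|stagings d beta L|)%N.
Proof.
move=> b1 L1 kL.
have [l lL lk] : exists2 l, l \in L & l != k.
  have : (0 < #|L :\ k|)%N by move: L1; rewrite (cardsD1 k) kL.
  by case/card_gt0P => l; rewrite !inE => /andP[lk lL]; exists l.
pose S v y := if y k == Some v then [set k; l] else [set k].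
pose f v y := restrict (S v y) y.
have SL v y : S v y \subset L.
  by rewrite /S; case: ifP => _; rewrite ?subUset !sub1set ?kL ?lL.
have kS v y : k \in S v y by rewrite /S; case: ifP; rewrite !inE eqxx.
have fk v y : f v y k = y k by rewrite ffunE kS.
have SE v y z : y k = z k -> S v y = S v z by rewrite /S => ->.
rewrite -[X in (X <= _)%N]card_ord.
rewrite -(@card_in_imset _ _ (fun v => preim_partition (f v) (cells d L))).
  apply/subset_leq_card/subsetP => _ /imsetP[v _ ->].
  apply: (@preim_partition_staging _ _ _ _ (f v)) => y.
  rewrite in_cells => /eqP yL.
  have domf : dom (f v y) = S v y.
    by rewrite dom_restrict yL; exact/setIidPl.
  rewrite domf SL; split=> //.
    apply: leq_trans b1; rewrite /S; case: ifP => _; last by rewrite cards1.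
    by rewrite cards2 eq_sym lk.
  move=> z _; have [yz|yz] := eqVneq (y k) (z k).
    by rewrite /f -(SE v _ _ yz) eq_sym agree_restrict // yL.
  transitivity false.
    by apply/negbTE; apply: contra yz => /eqP/ffunP/(_ k); rewrite !fk => /eqP.
  apply/esym/negbTE/agreeP => /(_ k); rewrite domf kS fk => /(_ isT) zy.
  by rewrite zy eqxx in yz.
(* Injectivity in [v]: the points [y] and [z] below both have state [v] at [k] and differ only at
   [l]. The map [f v] separates them, while [f w] with [w != v] does not. *)
move=> v w _ _ /preim_partition_eqE vw; apply/eqP; apply: contraT => vnw.
pose y := update (default L) v.
have yL : dom y = L by rewrite dom_update dom_default.
have yk : y k = Some v by rewrite update_eq.
have [u uy] := exists_neq (y l).
pose z := update y u.
have zL : dom z = L by rewrite dom_update yL.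
have zk : z k = Some v by rewrite update_neq // eq_sym.
have := vw y z; rewrite !in_cells yL zL eqxx => /(_ isT isT).
have -> : f w y == f w z.
  apply/eqP/ffunP => j; rewrite [LHS]ffunE [RHS]ffunE /S yk zk.
  have /negbTE -> : Some v != Some w by [].
  by rewrite inE; case: eqP => // ->; rewrite yk zk.
move/eqP/ffunP/(_ l); rewrite [LHS]ffunE [RHS]ffunE.
rewrite /S yk zk eqxx !inE eqxx orbT.
by rewrite update_eq => /esym/eqP; rewrite (negbTE uy).
Qed.

Lemma card_contexts_mul beta L e : (1 < beta)%N -> (forall k, d k <= e)%N ->
  (0 < e)%N ->
  (#|contexts beta L| * e <= 2 ^ #|L| * #|stagings d beta L| * e ^ beta)%N.
Proof.
move=> b1 de e0; have sgt0 := stagings_gt0 beta L.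
(* With at most one variable, a domain carries at most [e] contexts, and [e * e <= e ^ beta]
   suffices. Otherwise [leq_card_stagings] applies. *)
have [L1|L1] := leqP #|L| 1.
  apply: (@leq_trans (2 ^ #|L| * e ^ 1 * e)%N).
    rewrite leq_mul2r card_contexts ?orbT // => S SL _.
    apply: (@card_cells_leq S L) => //.
    exact: leq_trans (subset_leq_card SL) L1.
  rewrite -!mulnA leq_mul2l; apply/orP; right.
  apply: leq_trans (leq_pmull _ sgt0).
  by rewrite expn1 mulnn leq_pexp2l.
pose m := \max_(k in L) d k.
have m0 : (0 < m)%N.
  have /card_gt0P[k kL] : (0 < #|L|)%N by exact: ltnW.
  by apply: leq_trans (leq_bigmax_cond _ kL); exact: ltnW.
have me : (m <= e)%N by apply/bigmax_leqP.
have ms : (m <= #|stagings d beta L|)%N.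
  by apply/bigmax_leqP => k; exact: leq_card_stagings.
apply: (@leq_trans (2 ^ #|L| * m ^ beta * e)%N).
  rewrite leq_mul2r card_contexts ?orbT // => S SL Sb.
  apply: (@card_cells_leq S L) => // k kL; exact: leq_bigmax_cond.
rewrite -!mulnA leq_mul2l; apply/orP; right.
(* One factor [m] is bounded by the number of stagings, the remaining [m ^ b] by [e ^ b]. *)
case: beta b1 {sgt0} ms => // b b1 ms.
rewrite !expnS -mulnA leq_mul //  mulnC leq_mul2l leq_exp2r ?me ?orbT //.
Qed.

End Stagings.

(** * Cost of the marginals and of the scores *)

Section Scores.
Local Open Scope ring_scope.
Variables (R : realType) (p : nat) (d : 'I_p -> nat).
Hypothesis d_gt1 : forall k, (1 < d k)%N.
Let env := (seq (outcome d) * hyper R d)%type.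

Let d_gt0 k : (0 < d k)%N. Proof. exact: ltnW. Qed.

Definition marginal_value (i : 'I_p) (c : assignment d) (w : env) : R :=
  marginal w.1 w.2 i c.

Lemma computable_marginal_stored G (i : 'I_p) (c : assignment d) :
  computable (fun w : env => stored_input w.1 w.2) G 1 (marginal_value i c).
Proof. exact: (computable_input (i, c)). Qed.

Lemma computable_marginal_raw G (i : 'I_p) (c : assignment d) :
  computable (fun w : env => raw_input w.1 w.2) G (23 * d i)
    (marginal_value i c).
Proof.
have hyp (k : 'I_(d i)) :=
  computable_input (inp := fun w : env => raw_input w.1 w.2)
  (G := G) (Hyper c k).
have cnt (k : 'I_(d i)) :=
  computable_input (inp := fun w : env => raw_input w.1 w.2)
  (G := G) (Count c k).
have Sa := computable_sum (index_enum 'I_(d i)) (P := predT) (fun k _ => hyp k).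
have Sn := computable_sum (index_enum 'I_(d i)) (P := predT) (fun k _ => cnt k).
have Pr := computable_prod (index_enum 'I_(d i)) (P := predT)
  (fun k _ => computable_div (computable_Gamma (computable_add (hyp k) (cnt k)))
                             (computable_Gamma (hyp k))).
have := computable_mul (computable_div (computable_Gamma Sa)
  (computable_Gamma (computable_add Sa Sn))) Pr.
move/(computable_leq _)/(computable_ext _); apply.
  by move=> w; rewrite /marginal_value /marginal natr_sum.
(* The program has [14 * d i + 9] instructions, and [d i] is positive. *)
rewrite !sum_nat_const card_ord.
have := d_gt0 i; lia.
Qed.

Lemma computable_los (I : Type) (inp : env -> I -> R) G (beta e : nat)
    (i : 'I_p) (L : {set 'I_p}) :
  (forall k, d k <= e)%N -> (0 < e)%N ->
  (forall c, c \in contexts d beta L -> G (marginal_value i c)) ->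
  computable inp G (10 * (#|stagings d beta L| * e ^ beta))
    (fun w => los w.1 w.2 beta i L).
Proof.
move=> de e0 HG.
(* Five instructions give the weight, whose cardinal is a literal; one starts the product and one
   multiplies it by the weight. Each factor is in memory and costs one multiplication. *)
have cs s : s \in stagings d beta L -> computable inp G (e ^ beta + 7)
    (fun w => 1 / (i.+1%:R * #|stagings d beta L|%:R) *
      \prod_(c : assignment d | (dom c \subset L) && (stage L c \in s))
        marginal_value i c w).
  move=> sL; have mem c : (dom c \subset L) && (stage L c \in s) ->
      computable inp G 0 (marginal_value i c).
    move=> /andP[cL cs]; apply/computable_mem/HG.
    by rewrite inE cL (staging_context_card d_gt1 sL).
  have := computable_mul (computable_div (computable_nat 1)
    (computable_mul (computable_nat i.+1)
       (computable_nat #|stagings d beta L|)))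
    (computable_prod (index_enum (assignment d)) mem).
  apply: computable_leq; rewrite sum1_card.
  have := card_staging_contexts d_gt1 (fun k _ => de k) e0 sL.
  rewrite cardsE; lia.
have := computable_sum (index_enum {set {set assignment d}}) cs.
move/(computable_leq _)/(computable_ext _); apply=> //.
rewrite sum_nat_const.
have := stagings_gt0 d beta L; have : (0 < e ^ beta)%N by rewrite expn_gt0 e0.
nia.
Qed.

Lemma leq_sum_pairs (T : finType) (Q : 'I_p -> pred T) (n : 'I_p * T -> nat) m :
  (forall i, \sum_(t | Q i t) n (i, t) <= m)%N ->
  (\sum_(j : 'I_p * T | Q j.1 j.2) n j <= p * m)%N.
Proof.
move=> nm; rewrite (eq_bigr (fun j => n (j.1, j.2))); last by case.
rewrite -(pair_big_dep predT Q (fun i t => n (i, t))) /=.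
by rewrite -[X in (X * m)%N]card_ord -sum_nat_const; exact: leq_sum.
Qed.

Lemma scores_computable_in_time_leq (I : Type)
    (input : seq (outcome d) -> hyper R d -> I -> R) (beta m n : nat)
    (Ks : 'I_p -> {set 'I_p}) : (m <= n)%N ->
  scores_computable_in_time input beta Ks m ->
  scores_computable_in_time input beta Ks n.
Proof.
move=> mn [prog [out [pm outP]]]; exists prog, out; split=> //.
exact: leq_trans mn.
Qed.

(** Two phases: [q1] stores all marginals, at cost [q] each, and [q2] computes all scores from them.
    The parameters [q] and [A] let both input models share the argument. *)
Lemma scores_computable (I : Type)
    (input : seq (outcome d) -> hyper R d -> I -> R) (beta q e A W : nat)
    (Ks : 'I_p -> {set 'I_p}) :
  (forall k, d k <= e)%N -> (0 < e)%N ->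
  (forall G i c, computable (fun w : env => input w.1 w.2) G q
    (marginal_value i c)) ->
  (forall i, #|contexts d beta (Ks i)| * q <= A * W)%N ->
  (forall i, 2 ^ #|Ks i| * #|stagings d beta (Ks i)| * e ^ beta <= W)%N ->
  scores_computable_in_time input beta Ks ((A + 10) * (p * W)).
Proof.
move=> de e0 cm qA stW.
(* The memory is empty at first, so marginals are computed from no stored value. *)
have [||q1 q1s q1P] := @computable_family R I env (fun w => input w.1 w.2)
  ('I_p * assignment d)%type (index_enum _)
  (fun j => j.2 \in contexts d beta (Ks j.1)) (fun=> False) (fun=> q)
  (fun j => marginal_value j.1 j.2) [::] => //.
have [||q2 q2s q2P] := @computable_family R I env (fun w => input w.1 w.2)
  ('I_p * {set 'I_p})%type (index_enum _)
  (fun j => j.2 \subset Ks j.1)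
  (fun g => exists2 j, j.2 \in contexts d beta (Ks j.1) &
     g = marginal_value j.1 j.2)
  (fun j => 10 * (#|stagings d beta j.2| * e ^ beta))%N
  (fun j w => los w.1 w.2 beta j.1 j.2) q1.
- by move=> _ [j jK ->]; apply: q1P => //; rewrite mem_index_enum.
- move=> [i L] /= LK; apply: computable_los => // c cL.
  exists (i, c) => //=; move: cL; rewrite !inE => /andP[cL ->].
  by rewrite (fintype.subset_trans cL).
(* Choice collects the addresses into one function; pairs outside the requested range get the dummy
   address 0. *)
have /boolp.choice[out outP] : forall j : 'I_p * {set 'I_p}, exists a,
    j.2 \subset Ks j.1 -> forall w : env,
    (exec (input w.1 w.2) (q1 ++ q2))`_a = los w.1 w.2 beta j.1 j.2.
  move=> j; case: (boolP (j.2 \subset Ks j.1)) => jK; last by exists 0%N.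
  by have [|a _ aE] := q2P j _ jK; [rewrite mem_index_enum|exists a].
exists (q1 ++ q2), (fun i L => out (i, L)); split; last first.
  by move=> x alpha _ i L LK; exact: (outP (i, L) LK (x, alpha)).
rewrite size_cat mulnDl leq_add //.
  apply: leq_trans q1s _; rewrite mulnCA.
  apply: (leq_sum_pairs (Q := fun i c => c \in contexts d beta (Ks i))
    (n := fun=> q)) => i.
  by rewrite sum_nat_const.
apply: leq_trans q2s _; rewrite mulnCA.
apply: (@leq_sum_pairs {set 'I_p} (fun i L => L \subset Ks i)
  (fun j => 10 * (#|stagings d beta j.2| * e ^ beta))%N (10 * W)) => i /=.
rewrite -big_distrr leq_mul2l /= -big_distrl /=.
apply: leq_trans (stW i); rewrite leq_mul2r.
by rewrite sum_stagings_leq ?orbT.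
Qed.

End Scores.

(** * The time bound with an explicit constant *)

Theorem theorem2 (R : realType) :
  exists C : nat,
  forall (p : nat) (d : 'I_p -> nat) (beta : nat)
         (Ks : 'I_p -> {set 'I_p}) (K : {set 'I_p}),
    (forall k : 'I_p, 1 < d k)%N ->
    (0 < beta)%N ->
    (exists j : 'I_p, K = Ks j) ->
    (forall i : 'I_p, #|Ks i| <= #|K|)%N ->
    (forall i : 'I_p, #|stagings d beta (Ks i)| <= #|stagings d beta K|)%N ->
    let T := (p * 2 ^ #|K| * #|stagings d beta K|
                * (\max_(i < p) d i) ^ beta)%N in
    scores_computable_in_time (@stored_input R p d) beta Ks (C * T) /\
    ((1 < beta)%N ->
     scores_computable_in_time (@raw_input R p d) beta Ks (C * T)).
Proof.
(* Ten units of [p * W] pay for the scores and 23 for marginals computed from the counts, at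
   [23 * e] each. Stored marginals need only one unit, one fetch each. *)
exists 33%N => p d beta Ks K d_gt1 beta_gt0 [j KE] K_max stagings_max T.
set e := (\max_(i < p) d i)%N in T *.
have de k : (d k <= e)%N by exact: leq_bigmax.
have e_gt0 : (0 < e)%N by apply: leq_trans (de j); exact: ltnW.
pose W := (2 ^ #|K| * #|stagings d beta K| * e ^ beta)%N.
have WE : T = (p * W)%N by rewrite /T /W !mulnA.
have KsW i : (2 ^ #|Ks i| * #|stagings d beta (Ks i)| * e ^ beta <= W)%N.
  by rewrite !leq_mul // leq_exp2l.
split=> [|beta_gt1]; rewrite WE.
  apply: (@scores_computable_in_time_leq _ _ _ _ _ _ ((1 + 10) * (p * W))).
    by rewrite leq_mul2r orbT.
  apply: (scores_computable d_gt1 de e_gt0 (q := 1) (A := 1)) => // [G i c|i].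
    exact: computable_marginal_stored.
  rewrite muln1 mul1n; apply: leq_trans (KsW i).
  apply: leq_trans (card_contexts (M := e ^ beta) _) _ => [S SK Sb|].
    exact: card_cells_leq (fun k _ => de k) e_gt0.
  by rewrite leq_mul2r leq_pmulr ?orbT // stagings_gt0.
apply: (scores_computable d_gt1 de e_gt0 (q := 23 * e) (A := 23)) => //
  [G i c|i].
  apply: computable_leq _ (computable_marginal_raw d_gt1 _ _).
  by rewrite leq_mul2l de orbT.
rewrite mulnCA leq_mul2l; apply: leq_trans (KsW i).
exact: card_contexts_mul.
Qed.
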